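(* Let $1 \le k \le n-1$ be integers and let $\mathcal{F}$ be a family of subsets of $[n] = \{1,\dots,n\}$, each of size at most $k$, with $\emptyset \notin \mathcal{F}$. Suppose that for every two sets $A, B \in \mathcal{F}$ with $A \cap B = \emptyset$ we have $|A| + |B| \le k$. Then $$|\mathcal{F}| \le \binom{n-1}{k-1} + \binom{n-1}{k-2} + \cdots + \binom{n-1}{0}.$$ *)

(* Defs.v *)
From mathcomp Require Export all_boot.

(* Main.v *)
Require Import Defs.
From mathcomp Require Import all_boot zify.

(** Induction on the size of the ground set [D]. Fix [m] in [D]; shifting
    [m] to every other point, we may assume that [m |: A] in [F] implies
    [x |: A] in [F]. Split [F] into the sets avoiding [m] and the traces
    [A :\ m] of the sets containing [m], and look for the bounds with
    parameters [k] and [k - 1] on [D :\ m] (Pascal's rule). By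
    shiftedness two disjoint traces satisfy the condition, even with [k - 2],
    unless they partition [D :\ m]. To remove such pairs, fix [e] in [D :\ m]
    and, from each of them, transfer the trace containing [e] to the sets
    avoiding [m]: it is not already there because [F] has no complementary
    pair, and transferred traces meet in [e]. The gain of [k - 2] over [k - 1]
    pays for the empty trace, which occurs when [[set m]] is in [F]. The
    induction stops at [#|D| = k + 1], where [F] contains at most one set of
    each complementary pair. *)

Set Implicit Arguments.
Unset Strict Implicit.
Unset Printing Implicit Defensive.

Section Families.
Variable T : finType.
Implicit Types (D A B : {set T}) (F G : {set {set T}}) (k : nat) (m x : T).

Definition admissible D k F :=
  [/\ forall A, A \in F -> A \subset D,
      forall A, A \in F -> #|A| <= k,
      set0 \notin F
    & forall A B, A \in F -> B \in F -> [disjoint A & B] -> #|A| + #|B| <= k].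

(** The classical compression replacing [m] by [x]. A set whose image is already in [F] stays put,
    which makes the map injective on [F]. *)
Definition shift1 m x F A :=
  if [&& m \in A, x \notin A & x |: (A :\ m) \notin F] then x |: (A :\ m) else A.

Definition shift m x F := shift1 m x F @: F.

Lemma card_replace m x A : m \in A -> x \notin A -> #|x |: (A :\ m)| = #|A|.
Proof.
move=> mA xA; rewrite cardsU1 (cardsD1 m A) mA.
by rewrite !inE (negbTE xA) andbF.
Qed.

Lemma card_shift1 m x F A : #|shift1 m x F A| = #|A|.
Proof.
by rewrite /shift1; case: ifP => // /and3P[mA xA _]; rewrite card_replace.
Qed.

Lemma replace_inj m x A B : m \in A -> m \in B -> x \notin A -> x \notin B ->
  x |: (A :\ m) = x |: (B :\ m) -> A = B.
Proof.
move=> mA mB xA xB /setP eqAB; apply/setP=> y.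
have := eqAB y; rewrite !inE.
case: (eqVneq y x) => [->|_]; first by rewrite (negbTE xA) (negbTE xB).
by case: (eqVneq y m) => [->|_] //=; rewrite mA mB.
Qed.

Lemma shift1_inj m x F : {in F &, injective (shift1 m x F)}.
Proof.
move=> A B AF BF; rewrite /shift1.
case: ifP => [/and3P[mA xA nA]|_]; case: ifP => [/and3P[mB xB nB]|_] //.
- exact: replace_inj.
- by move=> E; rewrite E BF in nA.
- by move=> E; rewrite -E AF in nB.
Qed.

Lemma card_shift m x F : #|shift m x F| = #|F|.
Proof. exact/card_in_imset/shift1_inj. Qed.

(** Only a moved set [A] against an unmoved [B] needs care, since two moved sets share [x]. *)
Lemma admissible_shift D k F m x :
  x \in D -> admissible D k F -> admissible D k (shift m x F).
Proof.
move=> xD [subD szk n0 dis].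
have disj_new A B : A \in F -> B \in F -> m \in A -> x \notin A ->
    [disjoint x |: (A :\ m) & shift1 m x F B] -> #|A| + #|B| <= k.
  move=> AF BF mA xA; rewrite /shift1; case: ifP => [_|].
    by rewrite disjoints_subset => /subsetP/(_ x); rewrite !inE eqxx => /(_ isT).
  rewrite disjoints_subset => nB /subsetP sAB.
  have xB : x \notin B by have := sAB x; rewrite !inE eqxx => /(_ isT).
  have sAB' y : y \in A -> y != m -> y \notin B.
    by move=> yA ym; have := sAB y; rewrite !inE ym yA orbT => /(_ isT).
  case mB: (m \in B) nB; last first.
    move=> _; apply: dis => //; rewrite disjoints_subset; apply/subsetP=> y yA.
    rewrite inE; case: (eqVneq y m) => [->|]; [by rewrite mB | exact: sAB'].
  (* [B] stayed although it contains [m] and not [x], so [x |: (B :\ m)] is in [F]. It has the size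
     of [B] and is disjoint from [A]. *)
  rewrite xB /= => /negbFE B'F; rewrite -(card_replace mB xB).
  apply: dis => //; rewrite disjoints_subset; apply/subsetP=> y yA.
  rewrite !inE negb_or negb_and negbK.
  case: (eqVneq y x) => [yx|_]; first by rewrite -yx yA in xA.
  by case: (eqVneq y m) => //= ym; exact: sAB'.
split.
- move=> _ /imsetP[A AF ->]; rewrite /shift1; case: ifP => _; last exact: subD.
  by rewrite subUset sub1set xD (subset_trans (subsetDl _ _) (subD _ AF)).
- by move=> _ /imsetP[A AF ->]; rewrite card_shift1 szk.
- apply/imsetP=> -[A AF /(congr1 (fun B : {set T} => #|B|))].
  rewrite card_shift1 cards0 => /esym/eqP; rewrite cards_eq0 => /eqP A0.
  by rewrite -A0 AF in n0.
move=> _ _ /imsetP[A AF ->] /imsetP[B BF ->]; rewrite !card_shift1.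
case EA: [&& m \in A, x \notin A & x |: (A :\ m) \notin F].
  rewrite {1}/shift1 EA; case/and3P: EA => mA xA _; exact: disj_new.
case EB: [&& m \in B, x \notin B & x |: (B :\ m) \notin F].
  rewrite disjoint_sym {1}/shift1 EB addnC.
  by case/and3P: EB => mB xB _; exact: disj_new.
by rewrite /shift1 EA EB; exact: dis.
Qed.

(** Shifts are iterated while one changes the family; each strictly lowers the number of members
    containing [m]. *)
Lemma shift_stable D k F m : admissible D k F ->
  exists2 G, admissible D k G /\ #|G| = #|F| &
    forall x A, x \in D -> A \in G -> m \in A -> x \notin A ->
      x |: (A :\ m) \in G.
Proof.
move En: #|[set A in F | m \in A]| => n.
elim/ltn_ind: n F En => n IH F En adF.
case: (boolP [exists x in D, [exists A in F,
   [&& m \in A, x \notin A & x |: (A :\ m) \notin F]]]); last first.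
  move=> nex; exists F => // x A xD AF mA xA; apply: contraNT nex => nF.
  apply/existsP; exists x; rewrite xD; apply/existsP; exists A.
  by rewrite AF mA xA.
case/existsP=> x /andP[xD /existsP[A /andP[AF /and3P[mA xA nA]]]].
have mx : m != x by apply: contraNneq xA => <-.
have lt_n : #|[set B in shift m x F | m \in B]| < n.
  rewrite -En; apply/proper_card/properP; split.
    apply/subsetP=> B; rewrite !inE => /andP[/imsetP[C CF ->]].
    rewrite /shift1; case: ifP => _; last by rewrite CF.
    by rewrite !inE (negbTE mx) eqxx.
  exists A; rewrite !inE ?AF // mA andbT; apply/imsetP=> -[C CF].
  rewrite /shift1; case: ifP => [/and3P[mC xC _] EA|+ EA].
    by move: xA; rewrite EA !inE eqxx.
  by rewrite -EA mA xA nA.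
have [G [adG cG] stG] := IH _ lt_n _ erefl (admissible_shift m xD adF).
by exists G => //; split=> //; rewrite cG card_shift.
Qed.

Lemma sum_bin_lt n : (\sum_(0 <= i < n) 'C(n, i)).+1 = 2 ^ n.
Proof.
have -> : 2 ^ n = \sum_(i < n.+1) 'C(n, i).
  by rewrite -[2]/(1 + 1) expnDn; apply: eq_bigr => i _; rewrite !exp1n !muln1.
by rewrite big_ord_recr /= binn addn1 big_mkord.
Qed.

Lemma sum_binS n k : \sum_(0 <= i < k.+1) 'C(n.+1, i) =
  \sum_(0 <= i < k.+1) 'C(n, i) + \sum_(0 <= i < k) 'C(n, i).
Proof.
elim: k => [|k IH]; first by rewrite !big_nat1 big_geq // !bin0.
rewrite big_nat_recr //= IH binS.
by rewrite (big_nat_recr k.+1) //= (big_nat_recr k _ _ (leq0n k)) /= addnACA.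
Qed.

Lemma disjoints_setU1 x A B :
  [disjoint x |: A & B] = (x \notin B) && [disjoint A & B].
Proof. by rewrite !disjoints_subset subUset sub1set inE. Qed.

Lemma setD_setD D A : A \subset D -> D :\: (D :\: A) = A.
Proof. by move=> sAD; rewrite setDDr setDv set0U; exact/setIidPr. Qed.

(** Complementary sets have sizes adding up to [k.+1], so [F] and the family [C] of complements are
    disjoint. Both avoid [set0] and [D], whence [2 * #|F| <= 2 ^ k.+1 - 2]. *)
Lemma card_no_complement D k F : #|D| = k.+1 -> admissible D k F ->
  #|F| <= \sum_(0 <= i < k) 'C(k, i).
Proof.
move=> cD [subD szk n0 dis].
pose C := [set D :\: A | A in F].
have cC : #|C| = #|F|.
  apply: card_in_imset => A B AF BF E.
  by rewrite -(setD_setD (subD A AF)) E setD_setD // subD.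
have DF : D \notin F by apply/negP => /szk; rewrite cD ltnn.
have dFC : F :&: C = set0.
  apply/setP=> B; rewrite !inE; apply/negP=> /andP[BF /imsetP[A AF EB]].
  have : [disjoint A & B].
    by rewrite EB disjoints_subset setCD subsetUr.
  move/(dis _ _ AF BF); have := cardsD D A.
  rewrite (setIidPr (subD A AF)) -EB cD.
  have := subset_leq_card (subD A AF); rewrite cD; lia.
have : F :|: C \subset powerset D :\: [set set0; D].
  apply/subsetP=> B; rewrite !inE negb_or => /orP[BF|/imsetP[A AF ->]].
    rewrite subD // andbT.
    by apply/andP; split; [apply: contraNneq n0 | apply: contraNneq DF] => <-.
  rewrite subsetDl andbT; apply/andP; split.
    apply: contraNneq DF => /eqP; rewrite setD_eq0 => sDA.
    by have /eqP <- : A == D by rewrite eqEsubset subD.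
  apply: contraNneq n0 => E; suff <- : A = set0 by [].
  by rewrite -(setD_setD (subD A AF)) E setDv.
move/subset_leq_card; rewrite cardsU dFC cards0 subn0 cC cardsD card_powerset.
have /setIidPr -> : [set set0; D] \subset powerset D.
  by rewrite subUset !sub1set !inE sub0set subxx.
have D0 : set0 != D by rewrite eq_sym -card_gt0 cD.
rewrite cards2 D0 cD expnS -sum_bin_lt; lia.
Qed.

Lemma card_admissible D d k F : #|D| = d.+1 -> k <= d -> admissible D k F ->
  #|F| <= \sum_(0 <= i < k) 'C(d, i).
Proof.
elim: d D k F => [|d IH] D k F cD.
  by rewrite leqn0 => /eqP->; exact: card_no_complement.
rewrite leq_eqVlt => /predU1P[->|]; first exact: card_no_complement.
rewrite ltnS => le_kd; case: k le_kd => [_ [_ sz0 n0 _]|k le_kd].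
  rewrite big_geq // leqn0 cards_eq0; apply: contraNT n0 => /set0Pn[A AF].
  by have := sz0 A AF; rewrite leqn0 cards_eq0 => /eqP <-.
have /card_gt0P[m mD] : 0 < #|D| by rewrite cD.
case/(shift_stable m) => {}F [adF <-] st.
have [subD szk n0 dis] := adF.
have cD' : #|D :\ m| = d.+1 by move: cD; rewrite (cardsD1 m D) mD add1n => -[].
have /card_gt0P[e eD'] : 0 < #|D :\ m| by rewrite cD'.
pose F0 := [set A in F | m \notin A].
pose F1 := [set A :\ m | A in [set A in F | m \in A]].
have F1P A : A \in F1 -> [/\ A \subset D :\ m, m \notin A & m |: A \in F].
  case/imsetP=> B; rewrite inE => /andP[BF mB] ->; split.
  - by rewrite setSD // subD.
  - by rewrite !inE eqxx.
  - by rewrite setD1K.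
pose M := [set A in F1 | (e \in A) && (((D :\ m) :\: A) \in F1)].
have cF : #|F| = #|F0| + #|F1|.
  rewrite -(cardsID [set A : {set T} | m \in A] F) addnC; congr (_ + _).
    by apply: eq_card => A; rewrite !inE andbC.
  rewrite card_in_imset => [|A B].
    by apply: eq_card => A; rewrite !inE.
  by rewrite !inE => /andP[_ mA] /andP[_ mB] E; rewrite -(setD1K mA) E setD1K.
(* A common member [A] would put both [A] and its complement in [D] into [F], with sizes adding up
   to [#|D| > k.+1]. *)
have dFM : F0 :&: M = set0.
  apply/setP=> A; rewrite !inE; apply/negP.
  case/andP=> /andP[AF mA] /and3P[AF1 eA /F1P[sub' m' F']].
  have : [disjoint A & m |: (D :\ m :\: A)].
    rewrite disjoint_sym disjoints_setU1 mA /= disjoints_subset.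
    exact: subsetDr.
  move/(dis _ _ AF F').
  have [sA _ _] := F1P _ AF1.
  rewrite cardsU1 m' cardsD (setIidPr sA) cD' /=.
  by have := subset_leq_card sA; rewrite cD'; lia.
have subM : M \subset F1 by apply/subsetP=> A; rewrite inE => /andP[].
have -> : #|F| = #|F0 :|: M| + #|F1 :\: M|.
  rewrite cF cardsU dFM cards0 subn0 cardsD (setIidPr subM).
  by rewrite -addnA subnKC //; exact: subset_leq_card.
have ad0 : admissible (D :\ m) k.+1 (F0 :|: M).
  have disFM A B : A \in F0 -> B \in M -> [disjoint A & B] ->
      #|A| + #|B| <= k.+1.
    rewrite !inE => /andP[AF mA] /andP[/F1P[_ mB BF] _] dAB.
    have : [disjoint A & m |: B].
      by rewrite disjoint_sym disjoints_setU1 mA disjoint_sym.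
    by move/(dis _ _ AF BF); rewrite cardsU1 mB; lia.
  split.
  - move=> A /setUP[]; rewrite inE => /andP[]; last by case/F1P.
    by move=> AF mA; rewrite subsetD1 subD.
  - move=> A /setUP[]; rewrite inE => /andP[]; first by move=> /szk.
    by case/F1P=> _ mA /szk; rewrite cardsU1 mA; lia.
  - by rewrite !inE (negbTE n0) /= andbF.
  move=> A B /setUP[] A0 /setUP[] B0.
  - move: A0 B0; rewrite !inE => /andP[AF _] /andP[BF _]; exact: dis.
  - exact: disFM.
  - by rewrite disjoint_sym addnC; exact: disFM.
  move: A0 B0; rewrite !inE => /and3P[_ eA _] /and3P[_ eB _].
  by rewrite disjoints_subset => /subsetP/(_ _ eA); rewrite inE eB.
set H := F1 :\: M.
have HP A : A \in H -> [/\ A \subset D :\ m, m \notin A & m |: A \in F].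
  by case/setDP=> /F1P.
have disH A B : A \in H -> B \in H -> [disjoint A & B] ->
    #|A| + #|B| + 2 <= k.+1.
  move=> AH BH dAB; have [sA mA AF] := HP _ AH; have [sB mB BF] := HP _ BH.
  have sAB : A :|: B \subset D :\ m by rewrite subUset sA.
  case: (eqVneq (A :|: B) (D :\ m)) => [E|neq].
    have EB : D :\ m :\: A = B.
      rewrite -E setDUl setDv set0U; apply/setDidPl.
      by rewrite disjoint_sym.
    have EA : D :\ m :\: B = A by rewrite -EB setD_setD.
    (* Whichever of [A] and [B] contains [e] would lie in [M]. *)
    case/setDP: AH => AF1; case/setDP: BH => BF1.
    by rewrite !inE AF1 BF1 EA EB AF1 BF1 !andbT; move: eD';
      rewrite -E inE => /orP[] ->.
  (* A point [x] outside both traces gives disjoint members [x |: A] and [m |: B] of [F], each one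
     larger than its trace: hence the gain of 2. *)
  have /properP[_ [x xD]] : A :|: B \proper D :\ m by rewrite properEneq neq.
  rewrite inE negb_or => /andP[xA xB].
  have [xm xD0] : x != m /\ x \in D by apply/andP; rewrite -in_setD1.
  have xmA : x \notin m |: A by rewrite !inE negb_or xm.
  have := st x _ xD0 AF (setU11 _ _) xmA.
  rewrite setU1K // => AxF.
  have : [disjoint x |: A & m |: B].
    rewrite disjoints_setU1 !inE negb_or xm xB /=.
    by rewrite disjoint_sym disjoints_setU1 mA disjoint_sym.
  by move/(dis _ _ AxF BF); rewrite !cardsU1 xA mB !add1n addSn addnS addn2.
have szH A : A \in H -> #|A| <= k.
  by case/HP=> _ mA /szk; rewrite cardsU1 mA; lia.
rewrite sum_binS; apply: leq_add; first exact: IH ad0.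
case: (boolP (set0 \in H)) => [H0|nH0]; last first.
  apply: (IH (D :\ m)) => //; first exact: ltnW.
  split=> // [A /HP[] //|A B AH BH dAB].
  by have := disH _ _ AH BH dAB; lia.
have szH2 A : A \in H -> #|A| + 2 <= k.+1.
  by move=> /(disH _ _ H0); rewrite disjoints_subset sub0set cards0 => /(_ isT).
(* [set0] is disjoint from itself, so the gain of 2 applies to it too. *)
have k_gt0 : 0 < k by have := szH2 _ H0; rewrite cards0; lia.
rewrite (cardsD1 set0) H0.
have adH : admissible (D :\ m) k.-1 (H :\ set0).
  split.
  - by move=> A /setD1P[_ /HP[]].
  - by move=> A /setD1P[_ /szH2]; lia.
  - by rewrite !inE eqxx.
  - by move=> A B /setD1P[_ AH] /setD1P[_ BH] /(disH _ _ AH BH); lia.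
have le_k1d : k.-1 <= d by lia.
apply: leq_trans (leq_add (leqnn _) (IH _ _ _ cD' le_k1d adH)) _.
(* The top term ['C(d, k.-1)] is at least 1 and accounts for [set0]. *)
by rewrite -{2}(prednK k_gt0) big_nat_recr //= addnC leq_add2l bin_gt0.
Qed.

End Families.

Theorem theorem3p1 (n k : nat) (hk : 1 <= k <= n - 1)
    (F : {set {set 'I_n}})
    (hsize : forall A : {set 'I_n}, A \in F -> #|A| <= k)
    (hempty : set0 \notin F)
    (hdisj : forall A B : {set 'I_n},
        A \in F -> B \in F -> A :&: B = set0 -> #|A| + #|B| <= k) :
  #|F| <= \sum_(0 <= i < k) 'C(n - 1, i).
Proof.
case/andP: hk => k_gt0 le_kn; apply: (@card_admissible _ setT) => //.
  (* [1 <= k <= n - 1] forces [n > 0], so the truncated [n - 1] satisfies [n = (n - 1).+1]. *)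
  by rewrite cardsT card_ord; lia.
split=> // A B AF BF.
by move/disjoint_setI0; exact: hdisj.
Qed.
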